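(* Let $m,n$ be positive integers, $I=\{1,\dots,m\}$, $J=\{1,\dots,n\}$, let $A=(a_{ij})$ be an $m\times n$ matrix with entries in $[0,1]$, let $b=(b_i)\in[0,1]^m$, and let $c=(c_1,\dots,c_n)\in\mathbb{R}^n$. Suppose that $S(A,b)\neq\emptyset$, that $\bar X$ is an optimal solution of the problem of minimizing $Z_2(x)=\sum_{j=1}^n c_j^- x_j$ over $x\in S(A,b)$, and that $\underline{X}(e^* )$, with $e^*\in\bar E$, is an optimal solution of the problem of minimizing $Z_1(x)=\sum_{j=1}^n c_j^+ x_j$ over $x\in S(A,b)$. Define $x^*=[x_1^*,\dots,x_n^*]$ by $x_j^*=\bar X_j$ if $c_j\le 0$ and $x_j^*=\underline{X}(e^* )_j$ if $c_j>0$, for $j=1,\dots,n$. Then $x^*$ is an optimal solution of the problem of minimizing $\sum_{j=1}^n c_jx_j$ over $x\in S(A,b)$ (with optimal value $c^Tx^*$).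
   Context: $T_L(x,y)=\max\{x+y-1,0\}$ is the Lukasiewicz t-norm. The feasible set is $S(A,b)=\{x\in[0,1]^n:\ \max_{j=1}^n T_L(a_{ij},x_j)=b_i \text{ for all } i\in I\}$. For the cost vector, $c_j^+=\max\{c_j,0\}$ and $c_j^-=\min\{c_j,0\}$. For $i\in I$ let $J_i=\{j\in J: a_{ij}\ge b_i\}$. The vector $\bar X\in[0,1]^n$ is the componentwise minimum $\bar{X}=\min_{i\in I}\hat{x}_i$, where $(\hat{x}_i)_j=b_i+1-a_{ij}$ if $j\in J_i$, and $(\hat{x}_i)_j=1$ if $j\notin J_i$. For $i\in I$ let $\bar J_i=\{j\in J_i: T_L(a_{ij},\bar X_j)=b_i\}$. $\bar E$ is the set of all functions $e:I\to\bigcup_{i\in I}\bar J_i$ with $e(i)\in\bar J_i$ for every $i\in I$. For $i\in I$ and $j\in J_i$, the vector $\check{x}_i(j)$ is defined by $\check{x}_i(j)_k=b_i+1-a_{ij}$ if $b_i\ne 0$ and $k=j$, and $\check{x}_i(j)_k=0$ otherwise ($k\in J$). For a function $e$ on $I$ with $e(i)\in J_i$ for all $i\in I$, $\underline{X}(e)\in[0,1]^n$ is defined by $\underline{X}(e)_j=\max_{i\in I}\check{x}_i(e(i))_j$ for $j\in J$. *)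

(* Defs.v *)
From HB Require Import structures.
From mathcomp Require Import all_boot all_order all_algebra.
From mathcomp Require Import boolp classical_sets reals.

Set Implicit Arguments.
Unset Strict Implicit.
Unset Printing Implicit Defensive.

Import Order.TTheory GRing.Theory Num.Theory.
Local Open Scope classical_set_scope.
Local Open Scope ring_scope.

(* [R : realType] is the field of real numbers; I and J are
   ['I_m] and ['I_n], b is a column indexed by I, and x and c are rows indexed
   by J. *)

Section LukasiewiczSystem.
Variables (R : realType) (m n : nat).
Implicit Types (A : 'M[R]_(m, n)) (b : 'cV[R]_m) (c x : 'rV[R]_n).

Definition TL (x y : R) : R := Num.max (x + y - 1) 0.

(* The initial value 0 of the iterated maximum does not affect it, since
   [0 <= TL _ _] and n > 0 in all uses. *)
Definition feasible A b : set 'rV[R]_n :=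
  [set x : 'rV[R]_n | (forall j, 0 <= x 0 j <= 1) /\
    (forall i,
       \big[Num.max/0]_(j < n) TL (A i j) (x 0 j) = b i 0)].

Definition Jset A b (i : 'I_m) : {set 'I_n} := [set j | b i 0 <= A i j].

Definition xhat A b (i : 'I_m) : 'rV[R]_n :=
  \row_j (if j \in Jset A b i then b i 0 + 1 - A i j else 1).

(* The initial value 1 does not affect the minimum, since every entry of every
   [xhat A b i] is at most 1 and m > 0 in all uses. *)
Definition Xbar A b : 'rV[R]_n :=
  \row_j \big[Num.min/1]_(i < m) xhat A b i 0 j.

Definition Jbar A b (i : 'I_m) : {set 'I_n} :=
  [set j in Jset A b i | TL (A i j) (Xbar A b 0 j) == b i 0].

Definition Ebar A b : {set {ffun 'I_m -> 'I_n}} :=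
  [set e : {ffun 'I_m -> 'I_n} | [forall i, e i \in Jbar A b i]].

(* Meaningful for j in [Jset A b i]; the same formula is used for all j. *)
Definition xcheck A b (i : 'I_m) (j : 'I_n) : 'rV[R]_n :=
  \row_k (if (b i 0 != 0) && (k == j) then b i 0 + 1 - A i j else 0).

(* Meaningful when [e i] is in [Jset A b i] for all i. For A and b with entries
   in [0, 1], all the entries of the [xcheck A b i j] are then nonnegative, so
   the initial value 0 does not affect the maximum (m > 0). *)
Definition Xlow A b (e : {ffun 'I_m -> 'I_n}) : 'rV[R]_n :=
  \row_j \big[Num.max/0]_(i < m) xcheck A b i (e i) 0 j.

Definition cpos c : 'rV[R]_n := \row_j Num.max (c 0 j) 0.
Definition cneg c : 'rV[R]_n := \row_j Num.min (c 0 j) 0.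

Definition cost c x : R := \sum_(j < n) c 0 j * x 0 j.

Definition optimal_solution (Z : 'rV[R]_n -> R) (S : set 'rV[R]_n) x : Prop :=
  S x /\ forall y, S y -> Z x <= Z y.

Definition xstar A b c (e : {ffun 'I_m -> 'I_n}) : 'rV[R]_n :=
  \row_j (if c 0 j <= 0 then Xbar A b 0 j else Xlow A b e 0 j).

End LukasiewiczSystem.

(* Main.v *)
(** By monotonicity of the t-norm, every vector lying between two feasible
    vectors is feasible, and [Xbar] dominates all feasible vectors.  Hence
    [Xlow <= xstar <= Xbar] makes [xstar] feasible, and its cost splits as the
    sum of the two optimal values for [c^-] and [c^+]. *)

Require Import Defs.
From HB Require Import structures.
From mathcomp Require Import all_boot all_order all_algebra.
From mathcomp Require Import boolp classical_sets reals.

Set Implicit Arguments.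
Unset Strict Implicit.
Unset Printing Implicit Defensive.

Import Order.TTheory GRing.Theory Num.Theory.
Local Open Scope classical_set_scope.
Local Open Scope ring_scope.

Section Lukasiewicz.
Variables (R : realType) (m n : nat).
Implicit Types (A : 'M[R]_(m, n)) (b : 'cV[R]_m) (c x y z : 'rV[R]_n).

Lemma le_TL (u v w : R) : v <= w -> TL u v <= TL u w.
Proof. by move=> vw; rewrite /TL ge_max !le_max lexx orbT lerD2r lerD2l vw. Qed.

Lemma le_bigmax_TL A i x y : (forall j, x 0 j <= y 0 j) ->
  \big[Num.max/0]_(j < n) TL (A i j) (x 0 j) <=
  \big[Num.max/0]_(j < n) TL (A i j) (y 0 j).
Proof. by move=> xy; apply: le_bigmax2 => j _; exact: le_TL. Qed.

Lemma feasible_between A b x y z :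
  (forall j, x 0 j <= y 0 j) -> (forall j, y 0 j <= z 0 j) ->
  feasible A b x -> feasible A b z -> feasible A b y.
Proof.
move=> xy yz [x01 Ax] [z01 Az]; split=> [j|i].
  have /andP[x0 _] := x01 j; have /andP[_ z1] := z01 j.
  by rewrite (le_trans x0 (xy j)) (le_trans (yz j) z1).
(* The two occurrences of [b i 0] are replaced by different row values, at [z] above and at [x]
   below, which squeeze the row value at [y]. *)
by apply/eqP; rewrite eq_le -{1}(Az i) -(Ax i) !le_bigmax_TL.
Qed.

(** For [j] in [Jset A b i], equation [i] forces [A i j + x 0 j - 1 <= b i 0], which rearranges to
    the entry of [xhat]. The other entries, and the initial value of the minimum, are 1 and bound
    [x 0 j] by the box constraint. *)
Lemma feasible_le_Xbar A b x j : feasible A b x -> x 0 j <= Xbar A b 0 j.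
Proof.
move=> [x01 Ax]; have /andP[_ x1] := x01 j.
rewrite mxE; apply: le_bigmin => // i _; rewrite mxE; case: ifP => // _.
have : TL (A i j) (x 0 j) <= b i 0 by rewrite -(Ax i); exact: le_bigmax.
rewrite /TL ge_max => /andP[+ _].
by rewrite lerBlDr addrC -lerBrDr.
Qed.

Lemma cost_split c x : cost c x = cost (cneg c) x + cost (cpos c) x.
Proof.
rewrite /cost -big_split /=; apply: eq_bigr => j _.
by rewrite !mxE -mulrDl addr_min_max addr0.
Qed.

(** For each [j] one of the coefficients of [cneg c] and [cpos c] vanishes, and [xstar] takes its
    entry from the vector paired with the other one. *)
Lemma cost_xstar A b c e :
  cost c (xstar A b c e) =
  cost (cneg c) (Xbar A b) + cost (cpos c) (Xlow A b e).
Proof.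
rewrite /cost -big_split /=; apply: eq_bigr => j _; rewrite !mxE.
by case: (leP (c 0 j) 0) => cj; rewrite mul0r ?addr0 ?add0r.
Qed.

Lemma inf_optimal_solution (Z : 'rV[R]_n -> R) (S : set 'rV[R]_n) x :
  optimal_solution Z S x -> inf [set Z y | y in S] = Z x.
Proof.
move=> [Sx minx]; apply/eqP; rewrite eq_le; apply/andP; split.
  (* As [inf] is total, each inequality has a side condition: minimality of [x] gives the lower
     bound for this one, its membership in [S] gives nonemptiness for the next. *)
  by apply: ge_inf; [exists (Z x) => _ [y Sy <-]; exact: minx | exists x].
by apply: lb_le_inf; [exists (Z x), x | move=> _ [y Sy <-]; exact: minx].
Qed.

End Lukasiewicz.

Theorem theorem2 (R : realType) (m n : nat) (hm : (0 < m)%N) (hn : (0 < n)%N)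
    (A : 'M[R]_(m, n)) (hA : forall i j, 0 <= A i j <= 1)
    (b : 'cV[R]_m) (hb : forall i, 0 <= b i 0 <= 1)
    (c : 'rV[R]_n)
    (hS : feasible A b !=set0)
    (hXbar : optimal_solution (cost (cneg c)) (feasible A b) (Xbar A b))
    (e : {ffun 'I_m -> 'I_n}) (he : e \in Ebar A b)
    (hXlow : optimal_solution (cost (cpos c)) (feasible A b) (Xlow A b e)) :
  optimal_solution (cost c) (feasible A b) (xstar A b c e) /\
  inf [set cost c x | x in feasible A b] = cost c (xstar A b c e).
Proof.
have [fXbar minXbar] := hXbar; have [fXlow minXlow] := hXlow.
suff opt : optimal_solution (cost c) (feasible A b) (xstar A b c e).
  by split=> //; exact: inf_optimal_solution.
split=> [|y fy]; last first.
  by rewrite cost_xstar (cost_split c y) lerD ?minXbar ?minXlow.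
(* The comparison comes from the feasibility of [Xlow A b e], not from its formula. *)
have low_le_bar j : Xlow A b e 0 j <= Xbar A b 0 j by exact: feasible_le_Xbar.
by apply: (feasible_between _ _ fXlow fXbar) => j; rewrite [xstar _ _ _ _ _ _]mxE;
  case: ifP.
Qed.
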